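(* Let $L:\mathbb{R}^n\times\mathbb{R}^m\to\mathbb{R}\cup\{\infty\}$, $L(x,y)=f(x)+Q(x,y)+g(y)$, and let $(x_0,y_0)\in\mathbb{R}^n\times\mathbb{R}^m$ and positive sequences $\{\lambda_k\},\{\mu_k\}$ be such that assumptions $(\mathcal{H})$ and $(\mathcal{H}_1)$ (stated in the context) hold. Let $\{(x_k,y_k)\}$ be a sequence generated from $(x_0,y_0)$ by the alternating minimization algorithm \[ x_{k+1}\in\arg\min_{u\in\mathbb{R}^n}\Big\{L(u,y_k)+\frac{1}{2\lambda_k}\|u-x_k\|^2\Big\},\qquad y_{k+1}\in\arg\min_{v\in\mathbb{R}^m}\Big\{L(x_{k+1},v)+\frac{1}{2\mu_k}\|v-y_k\|^2\Big\}. \] Suppose that $\{(x_k,y_k)\}$ converges to $(x^\ast,y^\ast)$ and that $L$ satisfies the exponent PLK condition at $(x^\ast,y^\ast)$ with $\varphi(t)=Mt^{1-q}$, where $q\in[0,1)$ and $M>0$. Then: (i) If $q=0$, then $\{L(x_k,y_k)\}$ has finite termination. (ii) If $q\in(0,\tfrac12)$, then $\{L(x_k,y_k)\}$ either has finite termination or converges superlinearly to $L(x^\ast,y^\ast)$. (iii) If $q=\tfrac12$, then $\{L(x_k,y_k)\}$ converges linearly to $L(x^\ast,y^\ast)$. (iv) If $q\in(\tfrac12,1)$, then there exists $\gamma>0$ such that \[ L(x_k,y_k)-L(x^\ast,y^\ast)\le\gamma\,k^{-\frac{1}{2q-1}}\quad\text{for all } k\in\mathbb{N}=\{1,2,\dots\}.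 \]
   Context: Assumptions $(\mathcal{H})$: $L(x,y)=f(x)+Q(x,y)+g(y)$, where $f:\mathbb{R}^n\to\mathbb{R}\cup\{\infty\}$ and $g:\mathbb{R}^m\to\mathbb{R}\cup\{\infty\}$ are proper (i.e. finite at some point) and lower semicontinuous, not necessarily convex; $Q:\mathbb{R}^n\times\mathbb{R}^m\to\mathbb{R}$ is $C^1$-smooth; and $\nabla Q$ is Lipschitz continuous on bounded subsets of $\mathbb{R}^n\times\mathbb{R}^m$. Assumptions $(\mathcal{H}_1)$: $\inf_{\mathbb{R}^n\times\mathbb{R}^m}L>-\infty$; the function $L(\cdot,y_0)$ is proper; and for some positive numbers $r_-<r_+$ all stepsizes $\lambda_k,\mu_k$ belong to $(r_-,r_+)$. Subdifferential. For a proper function $h:\mathbb{R}^d\to\mathbb{R}\cup\{\infty\}$ with $\operatorname{dom}h=\{x: h(x)<\infty\}$, the regular (Fréchet) subdifferential at $x\in\operatorname{dom}h$ is \[ \partial_F h(x)=\Big\{v:\ \liminf_{u\to x,\,u\ne x}\frac{h(u)-h(x)-\langle v,u-x\rangle}{\|u-x\|}\ge0\Big\}, \] and the limiting (Mordukhovich) subdifferential $\partial h(\bar x)=\partial_M h(\bar x)$ at $\bar x\in\operatorname{dom}h$ is the set of all $v$ for which there exist $x_k\to\bar x$ with $h(x_k)\to h(\bar x)$ and $v_k\in\partial_F h(x_k)$ with $v_k\to v$. The convention $\operatorname{dist}(0,\emptyset)=\infty$ is used. Exponent PLK (Polyak–Łojasiewicz–Kurdyka) condition. A lower semicontinuous function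 $h:\mathbb{R}^d\to\mathbb{R}\cup\{\infty\}$ satisfies the exponent PLK condition at $\bar x\in\operatorname{dom}h$ with $\varphi(t)=Mt^{1-q}$, $M>0$, $q\in[0,1)$, if there exist $\eta\in(0,\infty)$ and a neighborhood $U$ of $\bar x$ such that \[ \varphi'\big(h(x)-h(\bar x)\big)\,\operatorname{dist}\big(0,\partial h(x)\big)\ge1\quad\text{for all }x\in U\text{ with }h(\bar x)<h(x)<h(\bar x)+\eta . \] Convergence notions. Write $\Psi_k=L(x_k,y_k)-L(x^\ast,y^\ast)$. ''Finite termination'' of $\{L(x_k,y_k)\}$ means that $\Psi_k=0$ for all sufficiently large $k$. ''Superlinear convergence'' means $\Psi_k\to 0$ and $\Psi_k/\Psi_{k-1}\to0$ as $k\to\infty$. ''Linear convergence'' means $\Psi_k\to 0$ and there is $c\in(0,1)$ with $\Psi_k\le c\,\Psi_{k-1}$ for all sufficiently large $k$. *)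

(* Defs.v *)
From HB Require Import structures.
From mathcomp Require Import all_boot all_order all_algebra.
From mathcomp Require Import all_classical all_reals all_analysis.

Set Implicit Arguments.
Unset Strict Implicit.
Unset Printing Implicit Defensive.

Import Order.TTheory GRing.Theory Num.Theory.
Import numFieldNormedType.Exports.

Local Open Scope classical_set_scope.
Local Open Scope ring_scope.

(* R^d is 'rV[R]_d with its library topology, and R^n x R^m is
   identified with R^(n + m) through row_mx, lsubmx and rsubmx. The library
   norm `|x| on 'rV[R]_d is the max norm, so the Euclidean norm is defined
   here and used wherever a norm occurs in a formula. *)

Definition dotp (R : realType) (d : nat) (u v : 'rV[R]_d) : R :=
  \sum_(i < d) u 0 i * v 0 i.

Definition enorm (R : realType) (d : nat) (u : 'rV[R]_d) : R :=
  Num.sqrt (dotp u u).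

(* Functions into R \cup {+oo} are \bar R-valued functions avoiding -oo; the
   last requirement is part of properness. *)
Definition proper_fun (R : realType) (T : Type) (h : T -> \bar R) : Prop :=
  (forall x, (-oo < h x)%E) /\ (exists x, (h x < +oo)%E).

Definition dom (R : realType) (T : Type) (h : T -> \bar R) : set T :=
  [set x | (h x < +oo)%E].

Definition argmin (R : realType) (T : Type) (F : T -> \bar R) : set T :=
  [set x | forall u, (F x <= F u)%E].

Definition grad (R : realType) (d : nat) (Q : 'rV[R]_d -> R) (z : 'rV[R]_d) :
    'rV[R]_d :=
  \row_(i < d) 'D_(delta_mx 0 i) Q z.

Definition C1_smooth (R : realType) (d : nat) (Q : 'rV[R]_d -> R) : Prop :=
  (forall z, differentiable Q z) /\ continuous (grad Q).

Definition grad_lipschitz_on_bounded (R : realType) (d : nat)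
    (Q : 'rV[R]_d -> R) : Prop :=
  forall B : set 'rV[R]_d, bounded_set B ->
    exists K : R, forall z w, B z -> B w ->
      enorm (grad Q z - grad Q w) <= K * enorm (z - w).

Definition objective (R : realType) (n m : nat) (f : 'rV[R]_n -> \bar R)
    (Q : 'rV[R]_(n + m) -> R) (g : 'rV[R]_m -> \bar R) (z : 'rV[R]_(n + m)) :
    \bar R :=
  (f (lsubmx z) + (Q z)%:E + g (rsubmx z))%E.

Definition assumptions_H (R : realType) (n m : nat) (f : 'rV[R]_n -> \bar R)
    (Q : 'rV[R]_(n + m) -> R) (g : 'rV[R]_m -> \bar R) : Prop :=
  [/\ proper_fun f /\ lower_semicontinuous f,
      proper_fun g /\ lower_semicontinuous g,
      C1_smooth Q &
      grad_lipschitz_on_bounded Q].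

Definition assumptions_H1 (R : realType) (n m : nat)
    (L : 'rV[R]_(n + m) -> \bar R) (y0 : 'rV[R]_m) (lambda mu : nat -> R) :
    Prop :=
  [/\ (-oo < ereal_inf (range L))%E,
      proper_fun (fun x : 'rV[R]_n => L (row_mx x y0)) &
      exists rm rp : R, [/\ 0 < rm, rm < rp &
        forall k, (rm < lambda k < rp) && (rm < mu k < rp)]].

Definition alternating_minimization (R : realType) (n m : nat)
    (L : 'rV[R]_(n + m) -> \bar R) (lambda mu : nat -> R)
    (x : nat -> 'rV[R]_n) (y : nat -> 'rV[R]_m) : Prop :=
  forall k : nat,
    argmin (fun u : 'rV[R]_n =>
      (L (row_mx u (y k))
         + ((2 * lambda k)^-1 * enorm (u - x k) ^+ 2)%:E)%E) (x k.+1) /\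
    argmin (fun v : 'rV[R]_m =>
      (L (row_mx (x k.+1) v)
         + ((2 * mu k)^-1 * enorm (v - y k) ^+ 2)%:E)%E) (y k.+1).

Definition frechet_subdiff (R : realType) (d : nat) (h : 'rV[R]_d -> \bar R)
    (x : 'rV[R]_d) : set 'rV[R]_d :=
  [set v | dom h x /\
    (0 <= limf_einf
       (fun u => (h u - h x - (dotp v (u - x))%:E) / (enorm (u - x))%:E)
       x^')%E].

Definition limiting_subdiff (R : realType) (d : nat) (h : 'rV[R]_d -> \bar R)
    (x : 'rV[R]_d) : set 'rV[R]_d :=
  [set v | dom h x /\
    exists (xs vs : nat -> 'rV[R]_d),
      [/\ xs k @[k --> \oo] --> x,
          h (xs k) @[k --> \oo] --> h x,
          (forall k, frechet_subdiff h (xs k) (vs k)) &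
          vs k @[k --> \oo] --> v]].

(* The infimum of the empty set is +oo. *)
Definition dist0 (R : realType) (d : nat) (A : set 'rV[R]_d) : \bar R :=
  ereal_inf [set (enorm v)%:E | v in A].

Definition PLK_condition (R : realType) (d : nat) (h : 'rV[R]_d -> \bar R)
    (xbar : 'rV[R]_d) (phi : R -> R) : Prop :=
  dom h xbar /\
  exists (eta : R) (U : set 'rV[R]_d), [/\ 0 < eta, nbhs xbar U &
    forall x, U x -> (h xbar < h x < h xbar + eta%:E)%E ->
      (1 <= (derive1 phi (fine (h x - h xbar)%E))%:E
              * dist0 (limiting_subdiff h x))%E].

Definition exponent_PLK (R : realType) (d : nat) (h : 'rV[R]_d -> \bar R)
    (xbar : 'rV[R]_d) (M q : R) : Prop :=
  PLK_condition h xbar (fun t : R => M * t `^ (1 - q)).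

(* Rates are stated for an extended-real gap: the initial gap may be +oo. *)

Definition finite_termination (R : realType) (Psi : nat -> \bar R) : Prop :=
  \forall k \near \oo, Psi k = 0%E.

(* The middle conjunct makes the quotients meaningful. *)
Definition superlinear_convergence (R : realType) (Psi : nat -> \bar R) :
    Prop :=
  [/\ Psi k @[k --> \oo] --> 0%E,
      (\forall k \near \oo, Psi k != 0%E) &
      (Psi k.+1 / Psi k)%E @[k --> \oo] --> 0%E].

Definition linear_convergence (R : realType) (Psi : nat -> \bar R) : Prop :=
  Psi k @[k --> \oo] --> 0%E /\
  exists c : R, 0 < c < 1 /\
    \forall k \near \oo, (Psi k.+1 <= c%:E * Psi k)%E.

(* Main.v *)
Require Import Defs.
From HB Require Import structures.
From mathcomp Require Import all_boot all_order all_algebra.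
From mathcomp Require Import all_classical all_reals all_analysis.
From mathcomp Require Import ring lra.

Set Implicit Arguments.
Unset Strict Implicit.
Unset Printing Implicit Defensive.

Import Order.TTheory GRing.Theory Num.Theory.
Import numFieldNormedType.Exports.

Local Open Scope classical_set_scope.
Local Open Scope ring_scope.

(** Each iterate solves two proximal subproblems. Comparing them with the previous
    iterate gives the sufficient decrease L(z_k) - L(z_{k+1}) >= c |z_{k+1} - z_k|^2.
    Their optimality conditions give a subgradient of L at z_{k+1} of norm at most
    C |z_{k+1} - z_k|; the cross term grad Q(x_{k+1}, y_{k+1}) - grad Q(x_{k+1}, y_k)
    is controlled by the Lipschitz bound. Comparing the subproblems with the limit
    point, together with lower semicontinuity, shows that L(z_k) tends to the value
    at the limit. The PLK inequality then turns these bounds into the scalar recursion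
    Psi_{k+1}^(2q) <= C (Psi_k - Psi_{k+1}), and all four rates follow from it. *)

(** * Euclidean norm *)

Section EuclideanNorm.
Context {R : realType}.

Lemma dotpDr d (w u v : 'rV[R]_d) : dotp w (u + v) = dotp w u + dotp w v.
Proof. by rewrite -big_split; apply: eq_bigr => i _; rewrite !mxE mulrDr. Qed.

Lemma dotpDl d (w u v : 'rV[R]_d) : dotp (u + v) w = dotp u w + dotp v w.
Proof. by rewrite -big_split; apply: eq_bigr => i _; rewrite !mxE mulrDl. Qed.

Lemma dotpNl d (u v : 'rV[R]_d) : dotp (- u) v = - dotp u v.
Proof. by rewrite -sumrN; apply: eq_bigr => i _; rewrite !mxE mulNr. Qed.

Lemma dotpZl d (a : R) (u v : 'rV[R]_d) : dotp (a *: u) v = a * dotp u v.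
Proof. by rewrite /dotp mulr_sumr; apply: eq_bigr => i _; rewrite !mxE mulrA. Qed.

Lemma dotpC d (u v : 'rV[R]_d) : dotp u v = dotp v u.
Proof. by apply: eq_bigr => i _; rewrite mulrC. Qed.

Lemma dotp_row_mx n m (a c : 'rV[R]_n) (b e : 'rV[R]_m) :
  dotp (row_mx a b) (row_mx c e) = dotp a c + dotp b e.
Proof.
rewrite /dotp big_split_ord; congr (_ + _); apply: eq_bigr => i _;
  by rewrite ?row_mxEl ?row_mxEr.
Qed.

Lemma dotp0l d (u : 'rV[R]_d) : dotp 0 u = 0.
Proof. by rewrite /dotp big1// => i _; rewrite mxE mul0r. Qed.

Lemma dotp_ge0 d (u : 'rV[R]_d) : 0 <= dotp u u.
Proof. by apply: sumr_ge0 => i _; rewrite -expr2 sqr_ge0. Qed.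

Lemma enorm_ge0 d (u : 'rV[R]_d) : 0 <= enorm u.
Proof. exact: sqrtr_ge0. Qed.

Lemma sqr_enorm d (u : 'rV[R]_d) : enorm u ^+ 2 = dotp u u.
Proof. by rewrite sqr_sqrtr// dotp_ge0. Qed.

Lemma enormN d (u : 'rV[R]_d) : enorm (- u) = enorm u.
Proof. by rewrite /enorm dotpNl dotpC dotpNl opprK. Qed.

Lemma enormB d (u v : 'rV[R]_d) : enorm (u - v) = enorm (v - u).
Proof. by rewrite -enormN opprB. Qed.

Lemma enorm0 d : enorm (0 : 'rV[R]_d) = 0.
Proof. by rewrite /enorm dotp0l sqrtr0. Qed.

Lemma sqr_enorm_row_mx n m (a : 'rV[R]_n) (b : 'rV[R]_m) :
  enorm (row_mx a b) ^+ 2 = enorm a ^+ 2 + enorm b ^+ 2.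
Proof. by rewrite !sqr_enorm dotp_row_mx. Qed.

Lemma enorm_lsubmx n m (z : 'rV[R]_(n + m)) : enorm (lsubmx z) <= enorm z.
Proof.
rewrite -ler_sqr ?nnegrE ?enorm_ge0// -{2}(hsubmxK z) sqr_enorm_row_mx.
by rewrite lerDl sqr_ge0.
Qed.

Lemma sub_row_mx n m (u a : 'rV[R]_n) (v b : 'rV[R]_m) :
  row_mx u v - row_mx a b = row_mx (u - a) (v - b).
Proof. by rewrite opp_row_mx add_row_mx. Qed.

Lemma enorm_sub_row_mx_lt n m (u a : 'rV[R]_n) (v b : 'rV[R]_m) (r : R) :
  enorm (u - a) < r / 2 -> enorm (v - b) < r / 2 ->
  enorm (row_mx u v - row_mx a b) < r.
Proof.
move=> ar br; have a0 := enorm_ge0 (u - a); have b0 := enorm_ge0 (v - b).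
rewrite -ltr_sqr ?nnegrE ?enorm_ge0//; last by lra.
rewrite sub_row_mx sqr_enorm_row_mx; nra.
Qed.

(** Coordinatewise this is (u_i - v_i)^2 >= 0. It takes the place of the triangle inequality when
    the squared subgradient norm is estimated. *)
Lemma sqr_enormD_le d (u v : 'rV[R]_d) :
  enorm (u + v) ^+ 2 <= 2 * enorm u ^+ 2 + 2 * enorm v ^+ 2.
Proof.
rewrite !sqr_enorm /dotp !mulr_sumr -big_split; apply: ler_sum => i _ /=.
rewrite !mxE; have := sqr_ge0 (u 0 i - v 0 i); nra.
Qed.

Lemma sqr_enormZ d (a : R) (u : 'rV[R]_d) :
  enorm (a *: u) ^+ 2 = a ^+ 2 * enorm u ^+ 2.
Proof. by rewrite !sqr_enorm dotpZl dotpC dotpZl expr2 mulrA. Qed.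

Lemma norm_le_enorm d (u : 'rV[R]_d) : `|u| <= enorm u.
Proof.
rewrite [leLHS]/Num.norm/= mx_normrE; apply: bigmax_le => [|[i j] _ /=].
  exact: enorm_ge0.
rewrite ord1 -ler_sqr ?nnegrE ?enorm_ge0// sqr_enorm /dotp (bigD1 j)//=.
rewrite -normrX ger0_norm ?sqr_ge0// expr2 lerDl.
by apply: sumr_ge0 => k _; rewrite -expr2 sqr_ge0.
Qed.

Lemma enorm_le_norm d (u : 'rV[R]_d) : enorm u <= d%:R * `|u|.
Proof.
have u0 : 0 <= d%:R * `|u| by rewrite mulr_ge0.
rewrite -ler_sqr ?nnegrE ?enorm_ge0// sqr_enorm exprMn.
have -> : d%:R ^+ 2 * `|u| ^+ 2 = d%:R * (\sum_(i < d) `|u| ^+ 2).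
  by rewrite sumr_const card_ord -(mulr_natl (_ ^+ 2)) mulrA.
apply: (@le_trans _ _ (\sum_(i < d) `|u| ^+ 2)).
  apply: ler_sum => i _; rewrite -expr2 -[leLHS]ger0_norm ?sqr_ge0// normrX.
  rewrite ler_sqr ?nnegrE// [leRHS]/Num.norm/= mx_normrE.
  by apply/bigmax_geP; right; exists (0, i).
(* The factor [d] enlarges a nonnegative sum only if it is at least 1; in dimension 0 the sum is
   empty. *)
have [d0|d0] := posnP d.
  by rewrite big1 ?mulr0// => i _; have := ltn_ord i; rewrite {2}d0.
rewrite ler_peMl//; first by apply: sumr_ge0 => i _; rewrite sqr_ge0.
by rewrite ler1n.
Qed.

(** Norm equivalence: the library neighborhoods are those of the max norm, and the two comparisons
    above turn them into Euclidean balls. *)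
Lemma nbhs_enormP d (z : 'rV[R]_d) (U : set 'rV[R]_d) :
  nbhs z U <-> exists2 e, 0 < e & forall u, enorm (u - z) < e -> U u.
Proof.
split.
  move/nbhs_normP => [e /= e0 zU]; exists e => // u uz; apply: zU => /=.
  by rewrite distrC (le_lt_trans (norm_le_enorm _)).
(* Dividing by [d.+1] keeps the divisor positive in dimension 0. *)
move=> [e e0 zU]; apply: (nbhs_normP z U).2; exists (e / d.+1%:R) => /=.
  by rewrite divr_gt0.
move=> u /=; rewrite distrC => uz; apply: zU.
apply: (le_lt_trans (enorm_le_norm _)).
apply: (@le_lt_trans _ _ (d.+1%:R * `|u - z|)).
  by rewrite ler_wpM2r// ler_nat.
by rewrite mulrC -ltr_pdivlMr.
Qed.

Lemma cvg_enorm d (u : nat -> 'rV[R]_d) (z : 'rV[R]_d) (e : R) :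
  u k @[k --> \oo] --> z -> 0 < e -> \forall k \near \oo, enorm (u k - z) < e.
Proof.
move=> uz e0.
have /uz // : nbhs z [set v | enorm (v - z) < e] by apply/nbhs_enormP; exists e.
Qed.

(** Expanding the increment on the standard basis identifies the differential with the dot product
    by [grad Q z]. The remainder is small relative to the max norm, hence relative to the larger
    Euclidean norm. *)
Lemma grad_expansion d (Q : 'rV[R]_d -> R) (z : 'rV[R]_d) :
  differentiable Q z -> forall e : R, 0 < e -> exists2 r, 0 < r &
  forall u, enorm (u - z) < r ->
    `|Q u - Q z - dotp (grad Q z) (u - z)| <= e * enorm (u - z).
Proof.
move=> dQ e e0.
have dE (h : 'rV[R]_d) : 'd Q z h = dotp (grad Q z) h.
  rewrite {1}(row_sum_delta h) linear_sum /dotp; apply: eq_bigr => i _.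
  by rewrite linearZ /= mxE deriveE// mulrC.
have := diff_locally dQ => /eqaddoP/(_ e e0).
move/nbhs_enormP => [r r0 H]; exists r => // u uz.
have := H (u - z); rewrite subr0 => /(_ uz) /=.
rewrite !fctE dE subrK opprD addrA => /le_trans; apply.
by rewrite ler_wpM2l ?(ltW e0)// norm_le_enorm.
Qed.

End EuclideanNorm.

(** * Fréchet subgradients *)

Section FrechetSubdifferential.
Context {R : realType}.

(** Replaces the lower limit of difference quotients by an inequality on a ball, asked only where
    [h] is finite: elsewhere the quotient is +oo. *)
Lemma frechet_subdiff_minorant d (h : 'rV[R]_d -> \bar R) (x v : 'rV[R]_d) (a : R) :
  h x = a%:E -> (forall u, -oo < h u)%E ->
  (forall e, 0 < e -> exists2 r, 0 < r & forall u b, h u = b%:E ->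
     enorm (u - x) < r -> a + dotp v (u - x) - e * enorm (u - x) <= b) ->
  frechet_subdiff h x v.
Proof.
move=> hx hNy H; split; first by rewrite /dom /= hx ltry.
apply/lee_addgt0Pr => e e0; rewrite -leeBlDr// sub0e.
have [r r0 Hr] := H e e0.
(* The lower limit is minus an infimum, over neighborhoods, of suprema of the negated quotient, so
   one punctured ball with supremum at most [e] suffices. *)
rewrite /limf_einf /limf_esup leeN2.
apply: (@le_trans _ _ (ereal_sup [set (- ((h u - h x - (dotp v (u - x))%:E)
    / (enorm (u - x))%:E))%E | u in [set u | enorm (u - x) < r /\ u != x]])).
  apply: ereal_inf_lbound; exists [set u | enorm (u - x) < r /\ u != x] => //.
  rewrite /dnbhs /within /=.
  have : nbhs x [set u | enorm (u - x) < r] by apply/nbhs_enormP; exists r.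
  by apply: filterS.
apply: ge_ereal_sup => _ [u [ur ux] <-].
have n0 : 0 < enorm (u - x).
  rewrite lt_neqAle enorm_ge0 andbT eq_sym; apply: contra ux => /eqP n0.
  rewrite -subr_eq0 -normr_eq0 eq_le normr_ge0 andbT -n0.
  exact: norm_le_enorm.
rewrite leeNl hx.
case hu : (h u) => [b| |]; [| |by have := hNy u; rewrite hu]; last first.
  have -> : (+oo - a%:E - (dotp v (u - x))%:E = +oo :> \bar R)%E by [].
  rewrite gt0_mulye ?leey//.
  by rewrite inver (gt_eqF n0) lte_fin invr_gt0.
rewrite inver (gt_eqF n0) -EFinN !lee_fin ler_pdivlMr//.
by have := Hr _ _ hu ur; lra.
Qed.

(** Constant sequences make a Fréchet subgradient a limiting one. *)
Lemma dist0_limiting_le d (h : 'rV[R]_d -> \bar R) (x v : 'rV[R]_d) :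
  frechet_subdiff h x v -> (dist0 (limiting_subdiff h x) <= (enorm v)%:E)%E.
Proof.
move=> hv; apply: ereal_inf_lbound; exists v => //; split; first by case: hv.
by exists (fun=> x), (fun=> v); split=> //; exact: cvg_cst.
Qed.

Lemma derive1_scaled_powR (M q t : R) : 0 < t ->
  derive1 (fun s : R => M * s `^ (1 - q)) t = M * ((1 - q) * t `^ (- q)).
Proof.
move=> t0; have tin : t \in `]0, +oo[%R by rewrite in_itv/= t0.
rewrite derive1Ml; last by apply: derivable_powR; rewrite ?inE/= ?in_itv/= ?t0.
congr (_ * _); rewrite powR_derive1//; congr (_ * _ `^ _); ring.
Qed.

End FrechetSubdifferential.

(** * Rates from the scalar recursion *)

Section Rates.
Context {R : realType}.

Lemma powR_bernoulli (t p : R) : 0 <= t -> 0 < p < 1 -> t `^ p <= 1 + p * (t - 1).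
Proof.
move=> t0 /andP[p0 p1].
have q0 : 0 < 1 - p by lra.
have := @conjugate_powR R (t `^ p) 1 p^-1 (1 - p)^-1 (powR_ge0 _ _) ler01.
rewrite !invr_gt0 !invrK => /(_ p0 q0); rewrite -powRrM mulfV ?gt_eqF// powRr1//.
rewrite powR1 mulr1 mul1r => /(_ _)/le_trans -> //; first by ring.
by lra.
Qed.

(* With [t = b ^ p / C] the recursion reads [b (1 + t) <= a], and Bernoulli's
   inequality at [(1 + t)^-1] bounds [(b (1 + t)) ^ (- p)] away from
   [b ^ (- p)]. *)
Lemma powRN_increment (a b C p X : R) : 0 < C -> 0 < p < 1 -> 0 < b -> b <= X ->
  b `^ (p + 1) <= C * (a - b) ->
  a `^ (- p) + p / (C + X `^ p) <= b `^ (- p).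
Proof.
move=> C0 /andP[p0 p1] b0 bX hab.
have bp0 : 0 < b `^ p by rewrite powR_gt0.
have bpX : b `^ p <= X `^ p.
  by apply: ge0_ler_powR => //; rewrite ?nnegrE ?ltW// (lt_le_trans b0).
have D0 : 0 < C + b `^ p by lra.
pose s := C / (C + b `^ p).
have s0 : 0 < s by rewrite divr_gt0.
have ba : b / s <= a.
  rewrite /s invf_div mulrA ler_pdivrMr//.
  move: hab; rewrite powRD; last by rewrite (gt_eqF b0) implybT.
  by rewrite (powRr1 (ltW b0)); lra.
have bs0 : 0 < b / s by rewrite divr_gt0.
have a0 : 0 < a by apply: lt_le_trans ba.
have step : a `^ (- p) <= b `^ (- p) * s `^ p.
  have sV : s^-1 `^ p = (s `^ p)^-1.
    by rewrite -powR_inv1 ?(ltW s0)// -powRrM mulN1r powRN.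
  have -> : b `^ (- p) * s `^ p = ((b / s) `^ p)^-1.
    by rewrite powRM ?invr_ge0 ?(ltW b0) ?(ltW s0)// sV invfM invrK powRN.
  rewrite powRN lef_pV2 ?posrE ?powR_gt0//.
  by apply: ge0_ler_powR; rewrite ?nnegrE ?(ltW p0) ?(ltW bs0) ?(ltW a0).
apply: (@le_trans _ _ (b `^ (- p) * (1 + p * (s - 1)) + p / (C + X `^ p))).
  rewrite lerD2r (le_trans step)// ler_wpM2l ?powR_ge0// powR_bernoulli ?ltW//.
  by rewrite p0.
rewrite -[leRHS]mulr1 -subr_ge0.
(* Since 1 - s = b^p / (C + b^p), the factor b^(-p) cancels and the gain is exactly p / (C + b^p);
   [b <= X] then makes it uniform. *)
have -> : b `^ (- p) * 1 - (b `^ (- p) * (1 + p * (s - 1)) + p / (C + X `^ p))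
   = p / (C + b `^ p) - p / (C + X `^ p).
  rewrite /s powRN; field; rewrite !gt_eqF//.
  by lra.
rewrite subr_ge0 ler_pM2l// lef_pV2 ?posrE//; lra.
Qed.

(** Indices start at 1 because the initial gap may be infinite. The recursion is asked only at a
    positive next gap: the PLK inequality holds only strictly above the limit value, and at [q = 0]
    the convention that 0 to the power 0 is 1 would contradict a vanishing gap. *)
Variables (P : nat -> R) (C q : R).
Hypotheses (C0 : 0 < C) (P0 : forall k, (0 < k)%N -> 0 <= P k)
  (Pdecr : forall k, (0 < k)%N -> P k.+1 <= P k)
  (Pcvg : forall e, 0 < e -> \forall k \near \oo, P k < e)
  (Prec : \forall k \near \oo, 0 < P k.+1 ->
     P k.+1 `^ (2 * q) <= C * (P k - P k.+1)).

Lemma gap_homo (i j : nat) : (0 < i)%N -> (i <= j)%N -> P j <= P i.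
Proof.
move=> i0; elim: j => [|j IH]; first by rewrite leqn0 => /eqP <-.
rewrite leq_eqVlt => /predU1P[->//|]; rewrite ltnS => ij.
by rewrite (le_trans (Pdecr _)) ?IH// (leq_trans i0).
Qed.

(** By monotonicity and nonnegativity, a gap that vanishes once vanishes from then on. *)
Lemma gap_zero_or_pos :
  (\forall k \near \oo, P k = 0) \/ forall k, (0 < k)%N -> 0 < P k.
Proof.
have [[k [k0 Pk]]|H] := pselect (exists k, (0 < k)%N /\ P k = 0).
  left; exists k => //= j kj; apply/eqP; rewrite eq_le P0 ?(leq_trans k0)//.
  by rewrite -Pk gap_homo.
right=> k k0; rewrite lt_neqAle P0// andbT eq_sym; apply/eqP => Pk.
by apply: H; exists k.
Qed.

(** At [q = 0] the power is 1, so a positive next gap forces 1 <= C (P_k - P_{k+1}), which is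
    impossible once P_k < 1/C. *)
Lemma rate_finite : q = 0 -> \forall k \near \oo, P k = 0.
Proof.
move=> q0; have [//|Ppos] := gap_zero_or_pos.
have Ci0 : 0 < C^-1 by rewrite invr_gt0.
have [K _ HK] : \forall k \near \oo, [/\ P k < C^-1,
    (0 < k)%N & 0 < P k.+1 -> P k.+1 `^ (2 * q) <= C * (P k - P k.+1)].
  by near=> k; split; near: k; [exact: Pcvg|exact: nbhs_infty_gt|exact: Prec].
have [PK K0 /(_ (Ppos K.+1 isT))] := HK K (leqnn K).
rewrite q0 mulr0 powRr0 => H.
have CP : 0 < C * P K.+1 by rewrite mulr_gt0// Ppos.
by move: PK; rewrite -(ltr_pM2l C0) mulfV ?gt_eqF// => PK; exfalso; lra.
Unshelve. all: by end_near. Qed.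

(** Split P_{k+1} as P_{k+1}^(1-2q) P_{k+1}^(2q). The second factor is at most C P_k by the
    recursion, and the first tends to 0 because 1 - 2q > 0. *)
Lemma rate_superlinear : 0 < q < 2^-1 -> (forall k, (0 < k)%N -> 0 < P k) ->
  P k.+1 / P k @[k --> \oo] --> 0.
Proof.
move=> /andP[q0 q1] Ppos; apply/cvgrPdist_lt => e e0.
have p0 : 0 < 1 - 2 * q by lra.
have eC0 : 0 < e / C by rewrite divr_gt0.
(* The threshold solving d^(1-2q) = e / C. *)
pose d := (e / C) `^ (1 - 2 * q)^-1.
have d0 : 0 < d by rewrite powR_gt0.
near=> k.
have k0 : (0 < k)%N by near: k; exact: nbhs_infty_gt.
have Pk := Ppos _ k0; have PSk := Ppos k.+1 isT.
have Pd : P k < d by near: k; exact: Pcvg.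
rewrite sub0r normrN ger0_norm ?divr_ge0 ?ltW//.
rewrite ltr_pdivrMr//.
have rec : P k.+1 `^ (2 * q) <= C * P k.
  have : P k.+1 `^ (2 * q) <= C * (P k - P k.+1).
    by move: PSk; near: k; exact: Prec.
  by move/le_trans; apply; rewrite ler_pM2l//; lra.
have small : P k.+1 `^ (1 - 2 * q) < e / C.
  have -> : e / C = d `^ (1 - 2 * q).
    by rewrite /d -powRrM mulVf ?gt_eqF// powRr1// ltW.
  apply: gt0_ltr_powR; rewrite ?nnegrE ?(ltW PSk) ?(ltW d0)//.
  exact: le_lt_trans (Pdecr k0) Pd.
have -> : P k.+1 = P k.+1 `^ (1 - 2 * q) * P k.+1 `^ (2 * q).
  by rewrite -powRD ?subrK ?powRr1 ?ltW// oner_eq0.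
apply: (@le_lt_trans _ _ (P k.+1 `^ (1 - 2 * q) * (C * P k))).
  by rewrite ler_wpM2l// powR_ge0.
have -> : e * P k = e / C * (C * P k) by field; rewrite gt_eqF.
by rewrite ltr_pM2r// mulr_gt0.
Unshelve. all: by end_near. Qed.

(** The recursion is now P_{k+1} <= C (P_k - P_{k+1}); solving for P_{k+1} gives the ratio C / (1 +
    C). *)
Lemma rate_linear : q = 2^-1 ->
  exists c : R, 0 < c < 1 /\ \forall k \near \oo, P k.+1 <= c * P k.
Proof.
have D0 : 0 < 1 + C by rewrite addr_gt0.
move=> q2.
exists (C / (1 + C)); split.
  by rewrite divr_gt0//= ltr_pdivrMr//; lra.
near=> k.
have k0 : (0 < k)%N by near: k; exact: nbhs_infty_gt.
have rec : 0 < P k.+1 -> P k.+1 `^ (2 * q) <= C * (P k - P k.+1).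
  by near: k; exact: Prec.
have [Pk|Pk] := ltP 0 (P k.+1); last first.
  by rewrite (le_trans Pk)// mulr_ge0 ?P0// ltW// divr_gt0.
move: (rec Pk); rewrite q2 mulfV// (powRr1 (ltW Pk)) => H.
rewrite mulrAC ler_pdivlMr//; lra.
Unshelve. all: by end_near. Qed.

(** With p = 2q - 1, [powRN_increment] makes P_k^(-p) grow by at least a fixed amount per step,
    hence at least linearly in k; taking the power -1/p gives the rate. *)
Lemma rate_sublinear : 2^-1 < q < 1 ->
  exists gamma : R, 0 < gamma /\
    forall k, (1 <= k)%N -> P k <= gamma * k%:R `^ (- (2 * q - 1)^-1).
Proof.
move=> /andP[q2 q1]; pose p := 2 * q - 1.
have p01 : 0 < p < 1 by rewrite /p; apply/andP; split; lra.
have p0 : 0 < p by case/andP: p01.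
have P10 : 0 <= P 1%N by exact: P0.
rewrite -/p.
(* A large enough constant covers the finitely many indices up to [K]. Adding 1 to [P 1] keeps that
   constant positive even if [P 1] is 0. *)
have early (K : nat) (g : R) : (0 < K)%N -> (P 1%N + 1) * K%:R `^ p^-1 <= g ->
    forall k, (0 < k <= K)%N -> P k <= g * k%:R `^ (- p^-1).
  move=> K0 Kg k /andP[k0 kK].
  have kp : 0 < (k%:R : R) `^ p^-1 by rewrite powR_gt0// ltr0n.
  rewrite powRN -ler_pdivrMr ?invr_gt0// invrK.
  apply: le_trans Kg; apply: ler_pM; [exact: P0|exact: ltW| |].
    by rewrite (le_trans (gap_homo _ k0))// lerDl.
  by apply: ge0_ler_powR; rewrite ?nnegrE ?ler_nat ?invr_ge0 ?(ltW p0).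
have gpos (K : nat) : (0 < K)%N -> 0 < (P 1%N + 1) * (K%:R : R) `^ p^-1.
  by move=> K0; rewrite mulr_gt0 ?powR_gt0 ?ltr0n//; lra.
have [[K _ HK]|Ppos] := gap_zero_or_pos.
  (* [K.+1] because [K] may be 0 and [early] takes a positive index. *)
  exists ((P 1%N + 1) * K.+1%:R `^ p^-1); split; first exact: gpos.
  move=> k k0; have [kK|kK] := leqP k K.+1.
    by apply: (early K.+1); rewrite ?k0.
  rewrite HK/=; last by rewrite (leq_trans _ (ltnW kK)).
  by rewrite mulr_ge0 ?powR_ge0// ltW// gpos.
have [K [K0 HK]] : exists K, (0 < K)%N /\ forall k, (K <= k)%N ->
    P k.+1 `^ (2 * q) <= C * (P k - P k.+1).
  case: Prec => K _ HK; exists K.+1; split=> // k Kk.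
  by apply: HK => //=; [exact: ltnW|exact: Ppos].
(* The increment of [powRN_increment] with [X = P 1], which bounds every later gap. *)
pose c := p / (C + (P 1%N) `^ p).
have c0 : 0 < c by rewrite divr_gt0// ltr_wpDr// powR_ge0.
(* The second entry starts the linear lower bound at [K], the first lets it pass from one index to
   the next. *)
pose dl := Num.min c (P K `^ (- p) / K%:R).
have dl0 : 0 < dl.
  by rewrite lt_min c0 divr_gt0 ?ltr0n// powR_gt0// Ppos.
have low j : dl * (K + j)%:R <= P (K + j)%N `^ (- p).
  elim: j => [|j IH].
    by rewrite addn0 -ler_pdivlMr ?ltr0n// /dl ge_min lexx orbT.
  rewrite addnS -natr1 mulrDr mulr1.
  apply: (@le_trans _ _ (P (K + j)%N `^ (- p) + c)).
    by rewrite lerD// /dl ge_min lexx.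
  apply: powRN_increment => //; first exact: Ppos.
    exact: gap_homo.
  rewrite /p subrK; apply: HK; exact: leq_addr.
exists (Num.max ((P 1%N + 1) * K%:R `^ p^-1) (dl `^ (- p^-1))); split.
  by rewrite lt_max gpos.
move=> k k0; have [kK|kK] := leqP k K.
  by apply: (early K); rewrite ?k0// le_max lexx.
have := low (k - K)%N; rewrite subnKC ?(ltnW kK)// => H.
apply: (@le_trans _ _ (dl `^ (- p^-1) * k%:R `^ (- p^-1))); last first.
  by rewrite ler_wpM2r ?powR_ge0// le_max lexx orbT.
have k0' : 0 < (k%:R : R) by rewrite ltr0n.
have Pk := Ppos _ k0.
rewrite -powRM ?(ltW dl0) ?(ltW k0')//.
have -> : P k = (P k `^ (- p)) `^ (- p^-1).
  by rewrite -powRrM mulrNN mulfV ?gt_eqF// powRr1// ltW.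
rewrite !(powRN _ p^-1) lef_pV2 ?posrE ?powR_gt0// ?mulr_gt0//.
by apply: ge0_ler_powR; rewrite ?nnegrE ?powR_ge0 ?invr_ge0 ?mulr_ge0 ?(ltW p0) ?(ltW dl0).
Qed.

End Rates.

(** * One step of alternating minimization *)

Section Steps.
Context {R : realType}.

(** A point where [h] is finite competes with [w], so the minimal value is finite and the optimality
    inequality can be read between reals. *)
Lemma argmin_perturbed (T : Type) (h F : T -> \bar R) (c : T -> R) (w : T) :
  proper_fun h -> (forall u, F u = h u + (c u)%:E)%E -> argmin F w ->
  exists a, h w = a%:E /\ forall u r, h u = r%:E -> a + c w <= r + c u.
Proof.
move=> [hNy [v hv]] FE Fw.
have [r hr] : exists r, h v = r%:E.
  by case hE : (h v) => [r| |]; [exists r|move: hv; rewrite hE ltxx|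
    have := hNy v; rewrite hE ltxx].
have [a ha] : exists a, h w = a%:E.
  case hE : (h w) => [a| |]; [by exists a| |by have := hNy w; rewrite hE ltxx].
  by have := Fw v; rewrite !FE hE hr.
exists a; split=> // u b hu.
by have := Fw u; rewrite !FE ha hu -!EFinD lee_fin.
Qed.

Variables (n m : nat) (f : 'rV[R]_n -> \bar R) (Q : 'rV[R]_(n + m) -> R)
  (g : 'rV[R]_m -> \bar R).
Let L := objective f Q g.

Lemma objective_row_mx u v : L (row_mx u v) = (f u + (Q (row_mx u v))%:E + g v)%E.
Proof. by rewrite /L /objective row_mxKl row_mxKr. Qed.

Lemma objective_gtNy z : proper_fun f -> proper_fun g -> (-oo < L z)%E.
Proof.
move=> [fNy _] [gNy _]; rewrite /L /objective.
have := fNy (lsubmx z); have := gNy (rsubmx z).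
by case: (f _) => [a| |]; case: (g _) => [b| |]//= _ _; rewrite ltNyr.
Qed.

Lemma objective_lty z : proper_fun f -> proper_fun g -> (L z < +oo)%E ->
  exists a b, [/\ f (lsubmx z) = a%:E, g (rsubmx z) = b%:E & L z = (a + Q z + b)%:E].
Proof.
move=> [fNy _] [gNy _]; rewrite /L /objective.
have := fNy (lsubmx z); have := gNy (rsubmx z).
by case: (f _) => [a| |]; case: (g _) => [b| |]//= _ _ _; exists a, b.
Qed.

Lemma sqr_enormD_expand d (u v : 'rV[R]_d) :
  enorm (u + v) ^+ 2 = enorm u ^+ 2 + 2 * dotp v u + enorm v ^+ 2.
Proof. rewrite !sqr_enorm dotpDr !dotpDl (dotpC u v); ring. Qed.

Variables (x0 x1 : 'rV[R]_n) (y0 y1 : 'rV[R]_m) (a b c1 c2 : R).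
Hypotheses (pf : proper_fun f) (pg : proper_fun g)
  (dQ : forall z, differentiable Q z) (c10 : 0 <= c1) (c20 : 0 <= c2)
  (fx1 : f x1 = a%:E) (gy1 : g y1 = b%:E)
  (optx : forall u r, f u = r%:E ->
    a + (Q (row_mx x1 y0) + c1 * enorm (x1 - x0) ^+ 2) <=
    r + (Q (row_mx u y0) + c1 * enorm (u - x0) ^+ 2))
  (opty : forall v r, g v = r%:E ->
    b + (Q (row_mx x1 y1) + c2 * enorm (y1 - y0) ^+ 2) <=
    r + (Q (row_mx x1 v) + c2 * enorm (v - y0) ^+ 2)).

(** The optimality conditions suggest the subgradients -grad_x Q(x1, y0) - 2 c1 (x1 - x0) of [f] and
    -grad_y Q(x1, y1) - 2 c2 (y1 - y0) of [g]. Adding grad Q(x1, y1) leaves this vector; a gradient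
    difference survives only in the first block. *)
Definition step_subgrad : 'rV[R]_(n + m) :=
  row_mx (lsubmx (grad Q (row_mx x1 y1) - grad Q (row_mx x1 y0))
            - (2 * c1) *: (x1 - x0))
         (- ((2 * c2) *: (y1 - y0))).

(* Adding the two optimality inequalities bounds [L] from below, up to a
   constant, by [Q (u, v) - Q (u, y0) - Q (x1, v)] minus the two quadratic
   terms; this minorant touches [L] at [(x1, y1)], where its gradient is
   [step_subgrad]. *)
Lemma step_subgrad_frechet : frechet_subdiff L (row_mx x1 y1) step_subgrad.
Proof.
apply: (@frechet_subdiff_minorant _ _ _ _ _ (a + Q (row_mx x1 y1) + b)).
- by rewrite objective_row_mx fx1 gy1.
- by move=> z; exact: objective_gtNy.
move=> e e0; have e40 : 0 < e / 4 by lra.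
have [r1 r10 E1] := grad_expansion (dQ (row_mx x1 y1)) e40.
have [r2 r20 E2] := grad_expansion (dQ (row_mx x1 y0)) e40.
have D0 : 0 < c1 + c2 + 1 by rewrite ltr_wpDl// addr_ge0.
(* The error [e] is split into four quarters: three first-order expansions, of Q at (u, v), (u, y0)
   and (x1, v), and the quadratic terms, which the last radius makes at most e/4 times the
   distance. *)
exists (Num.min (Num.min r1 r2) (e / 4 / (c1 + c2 + 1))).
  by rewrite !lt_min r10 r20 divr_gt0.
move=> z t Lz; rewrite !lt_min => /andP[/andP[zr1 zr2]].
rewrite ltr_pdivlMr// => zr3.
have [|r [s [fr gs]]] := objective_lty (z := z) pf pg; first by rewrite Lz ltry.
rewrite Lz => -[->] {t Lz}.
have zE : z = row_mx (lsubmx z) (rsubmx z) by rewrite hsubmxK.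
move: fr gs zr1 zr2 zr3; rewrite {}zE; move: (lsubmx z) (rsubmx z) => u v {z}.
rewrite row_mxKl row_mxKr => fu gv.
set N := enorm _ => zr1 zr2 zr3.
have N0 : 0 <= N by exact: enorm_ge0.
have NE : N ^+ 2 = enorm (u - x1) ^+ 2 + enorm (v - y1) ^+ 2.
  by rewrite /N sub_row_mx sqr_enorm_row_mx.
have Nx : enorm (row_mx (u - x1) (0 : 'rV[R]_m)) <= N.
  rewrite -ler_sqr ?nnegrE ?enorm_ge0// NE sqr_enorm_row_mx enorm0.
  by rewrite lerD2l expr0n/= sqr_ge0.
have Ny : enorm (row_mx (0 : 'rV[R]_n) (v - y1)) <= N.
  rewrite -ler_sqr ?nnegrE ?enorm_ge0// NE sqr_enorm_row_mx enorm0.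
  by rewrite lerD2r expr0n/= sqr_ge0.
have := E1 (row_mx u v) zr1; rewrite -/N ler_norml => /andP[H1 _].
have := E2 (row_mx u y0); rewrite (sub_row_mx u x1 y0 y0) subrr.
move=> /(_ (le_lt_trans Nx zr2)).
rewrite ler_norml => /andP[_ H2].
have := E1 (row_mx x1 v); rewrite (sub_row_mx x1 x1 v y1) subrr.
move=> /(_ (le_lt_trans Ny zr1)).
rewrite ler_norml => /andP[_ H3].
have H2' := ler_wpM2l (ltW e40) Nx; have H3' := ler_wpM2l (ltW e40) Ny.
have := optx fu; have := opty gv.
have -> : u - x0 = (u - x1) + (x1 - x0) by rewrite addrA subrK.
have -> : v - y0 = (v - y1) + (y1 - y0) by rewrite addrA subrK.
rewrite (sqr_enormD_expand (u - x1)) (sqr_enormD_expand (v - y1)) => Hy Hx.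
have Hq : c1 * enorm (u - x1) ^+ 2 + c2 * enorm (v - y1) ^+ 2 <= e / 4 * N.
  apply: (@le_trans _ _ ((c1 + c2 + 1) * N ^+ 2)).
    have X0 := sqr_ge0 (enorm (u - x1)); have Y0 := sqr_ge0 (enorm (v - y1)).
    by have := mulr_ge0 c10 Y0; have := mulr_ge0 c20 X0; rewrite NE; lra.
  by rewrite expr2 mulrA ler_wpM2r// mulrC ltW.
move: H1 H2 H3; rewrite /step_subgrad sub_row_mx dotp_row_mx.
move: (grad Q (row_mx x1 y1)) (grad Q (row_mx x1 y0)) => G H.
have dE (V : 'rV[R]_(n + m)) p1 p2 :
    dotp V (row_mx p1 p2) = dotp (lsubmx V) p1 + dotp (rsubmx V) p2.
  by rewrite -{1}(hsubmxK V) dotp_row_mx.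
rewrite !dE (dotpC _ 0) dotp0l (dotpC _ 0) dotp0l linearB/= !dotpDl !dotpNl !dotpZl.
move=> H1 H2 H3.
lra.
Qed.

(** The two gradients are taken at points differing only in [y], so the Lipschitz bound involves
    only y1 - y0. Squaring the sum in the first block doubles both of its terms; the second block
    adds one more c^2. *)
Lemma sqr_enorm_step_subgrad (K c : R) : 2 * c1 <= c -> 2 * c2 <= c ->
  enorm (grad Q (row_mx x1 y1) - grad Q (row_mx x1 y0)) <=
    K * enorm (row_mx x1 y1 - row_mx x1 y0) ->
  enorm step_subgrad ^+ 2 <= (2 * K ^+ 2 + 3 * c ^+ 2) *
    (enorm (x1 - x0) ^+ 2 + enorm (y1 - y0) ^+ 2).
Proof.
move=> c1c c2c; rewrite sub_row_mx subrr => HK.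
have {HK} : enorm (grad Q (row_mx x1 y1) - grad Q (row_mx x1 y0)) ^+ 2 <=
    K ^+ 2 * enorm (y1 - y0) ^+ 2.
  have -> : enorm (y1 - y0) ^+ 2 = enorm (row_mx (0 : 'rV[R]_n) (y1 - y0)) ^+ 2.
    by rewrite sqr_enorm_row_mx enorm0 expr0n/= add0r.
  rewrite -exprMn ler_sqr ?nnegrE ?enorm_ge0//.
  exact: le_trans (enorm_ge0 _) HK.
rewrite /step_subgrad; set D := grad Q _ - _ => HD.
rewrite sqr_enorm_row_mx enormN sqr_enormZ.
have HDl : enorm (lsubmx D) ^+ 2 <= enorm D ^+ 2.
  by rewrite ler_sqr ?nnegrE ?enorm_ge0// enorm_lsubmx.
have := sqr_enormD_le (lsubmx D) (- ((2 * c1) *: (x1 - x0))).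
rewrite enormN sqr_enormZ => Hs.
have sq t : 0 <= t -> 2 * t <= c -> (2 * t) ^+ 2 <= c ^+ 2 by move=> *; nra.
have Hx := ler_wpM2r (sqr_ge0 (enorm (x1 - x0))) (sq _ c10 c1c).
have Hy := ler_wpM2r (sqr_ge0 (enorm (y1 - y0))) (sq _ c20 c2c).
have Kx : 0 <= K ^+ 2 * enorm (x1 - x0) ^+ 2 by rewrite mulr_ge0 ?sqr_ge0.
have Ky : 0 <= K ^+ 2 * enorm (y1 - y0) ^+ 2 by rewrite mulr_ge0 ?sqr_ge0.
have cx : 0 <= c ^+ 2 * enorm (x1 - x0) ^+ 2 by rewrite mulr_ge0 ?sqr_ge0.
have cy : 0 <= c ^+ 2 * enorm (y1 - y0) ^+ 2 by rewrite mulr_ge0 ?sqr_ge0.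
lra.
Qed.

End Steps.

(** * Convergence of the iterates *)

Section Convergence.
Context {R : realType}.

Lemma cvg_row_mx n m (u : nat -> 'rV[R]_n) (v : nat -> 'rV[R]_m)
    (us : 'rV[R]_n) (vs : 'rV[R]_m) :
  u k @[k --> \oo] --> us -> v k @[k --> \oo] --> vs ->
  row_mx (u k) (v k) @[k --> \oo] --> row_mx us vs.
Proof.
move=> uc vc U /nbhs_enormP [e e0 eU].
have e20 : 0 < e / 2 by lra.
suff : \forall k \near \oo, U (row_mx (u k) (v k)) by [].
near=> k; apply: eU; apply: enorm_sub_row_mx_lt;
  by near: k; exact: cvg_enorm.
Unshelve. all: by end_near. Qed.

Lemma lower_semicontinuous_cvg d (h : 'rV[R]_d -> \bar R) (u : nat -> 'rV[R]_d)
    (us : 'rV[R]_d) (t : R) :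
  lower_semicontinuous h -> u k @[k --> \oo] --> us -> (t%:E < h us)%E ->
  \forall k \near \oo, (t%:E < h (u k))%E.
Proof.
by move=> lsc uc /lsc[V /uc Vu VP]; near=> k; apply: VP; near: k; exact: Vu.
Unshelve. all: by end_near. Qed.

Lemma continuous_cvg_near d (Q : 'rV[R]_d -> R) (u : nat -> 'rV[R]_d)
    (us : 'rV[R]_d) (e : R) :
  differentiable Q us -> u k @[k --> \oo] --> us -> 0 < e ->
  \forall k \near \oo, `|Q us - Q (u k)| < e.
Proof.
move=> dQ uc e0; have /cvgrPdist_lt/(_ _ e0) : Q (u k) @[k --> \oo] --> Q us => //.
exact: (cvg_comp _ _ uc (differentiable_continuous dQ)).
Qed.

Lemma bounded_enorm_ball d (z : 'rV[R]_d) (r : R) :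
  bounded_set [set u | enorm (u - z) < r].
Proof.
exists (`|z| + r); split; first by rewrite num_real.
move=> M zM u /= ur; rewrite -(subrK z u) (le_trans (ler_normD _ _))//.
have := norm_le_enorm (u - z); lra.
Qed.

End Convergence.

(** * The iteration: finiteness, descent, limit of the values, PLK recursion *)

Section Algorithm.
Context {R : realType} (n m : nat)
    (f : 'rV[R]_n -> \bar R) (Q : 'rV[R]_(n + m) -> R)
    (g : 'rV[R]_m -> \bar R)
    (lambda mu : nat -> R)
    (x : nat -> 'rV[R]_n) (y : nat -> 'rV[R]_m)
    (xs : 'rV[R]_n) (ys : 'rV[R]_m) (rm rp : R).
Let L := objective f Q g.
Hypotheses (pf : proper_fun f) (pg : proper_fun g)
  (lf : lower_semicontinuous f) (lg : lower_semicontinuous g)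
  (dQ : forall z, differentiable Q z)
  (lipQ : grad_lipschitz_on_bounded Q)
  (p0 : proper_fun (fun u : 'rV[R]_n => L (row_mx u (y 0%N))))
  (rm0 : 0 < rm)
  (steps : forall k, (rm < lambda k < rp) && (rm < mu k < rp))
  (alt : alternating_minimization L lambda mu x y)
  (xc : x k @[k --> \oo] --> xs) (yc : y k @[k --> \oo] --> ys)
  (doms : dom L (row_mx xs ys)).

(** [fine] sends +oo to 0, so [X 0] and [V 0] carry no information when [f (x 0)] is infinite; [V]
    represents the objective from index 1 on. *)
Let X k := fine (f (x k)).
Let Y k := fine (g (y k)).
Let V k := X k + Q (row_mx (x k) (y k)) + Y k.
Let c1 k := (2 * lambda k)^-1.
Let c2 k := (2 * mu k)^-1.

(** A finite [g (y k)] is an additive constant of the subproblem: it joins the real perturbation of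
    [f] and cancels. *)
Lemma x_step k : g (y k) = (Y k)%:E ->
  f (x k.+1) = (X k.+1)%:E /\ forall u r, f u = r%:E ->
    X k.+1 + (Q (row_mx (x k.+1) (y k)) + c1 k * enorm (x k.+1 - x k) ^+ 2) <=
    r + (Q (row_mx u (y k)) + c1 k * enorm (u - x k) ^+ 2).
Proof.
move=> gy; pose c u := Q (row_mx u (y k)) + Y k + c1 k * enorm (u - x k) ^+ 2.
have [|a [fa opt]] := argmin_perturbed (c := c) pf _ (alt k).1.
  by move=> u; rewrite /L objective_row_mx gy -!addeA -!EFinD /c addrA.
have aX : X k.+1 = a by rewrite /X fa.
split=> [|u r fu]; first by rewrite aX.
by have := opt u r fu; rewrite aX /c; lra.
Qed.

Lemma y_step k : f (x k.+1) = (X k.+1)%:E ->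
  g (y k.+1) = (Y k.+1)%:E /\ forall v r, g v = r%:E ->
    Y k.+1 + (Q (row_mx (x k.+1) (y k.+1)) + c2 k * enorm (y k.+1 - y k) ^+ 2) <=
    r + (Q (row_mx (x k.+1) v) + c2 k * enorm (v - y k) ^+ 2).
Proof.
move=> fx; pose c v := X k.+1 + Q (row_mx (x k.+1) v) + c2 k * enorm (v - y k) ^+ 2.
have [|a [ga opt]] := argmin_perturbed (c := c) pg _ (alt k).2.
  by move=> v; rewrite /L objective_row_mx fx [in RHS]addeC /c 2!EFinD addeAC.
have aY : Y k.+1 = a by rewrite /Y ga.
split=> [|v r gv]; first by rewrite aY.
by have := opt v r gv; rewrite aY /c; lra.
Qed.

(** Finiteness passes alternately from [g (y k)] to [f (x k.+1)] to [g (y k.+1)]; it starts from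
    properness of [L] in its first variable at [y 0]. *)
Lemma g_finite k : g (y k) = (Y k)%:E.
Proof.
elim: k => [|k IH]; last by have [fx _] := x_step IH; have [] := y_step fx.
have [_ [u /(objective_lty pf pg)[_ [b [_ gb _]]]]] := p0.
by move: gb; rewrite row_mxKr /Y => ->.
Qed.

Lemma f_finite k : f (x k.+1) = (X k.+1)%:E.
Proof. by have [] := x_step (g_finite k). Qed.

Lemma objective_iterate k : (0 < k)%N -> L (row_mx (x k) (y k)) = (V k)%:E.
Proof.
by case: k => // k _; rewrite /L objective_row_mx f_finite g_finite -!EFinD.
Qed.

Lemma c_bounds k : [/\ (2 * rp)^-1 <= c1 k, (2 * rp)^-1 <= c2 k,
  2 * c1 k <= rm^-1 & 2 * c2 k <= rm^-1].
Proof.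
have := steps k => /andP[/andP[l1 l2] /andP[m1 m2]].
have r0 := rm0; have l0 : 0 < lambda k by lra.
have m0 : 0 < mu k by lra.
have rp0 : 0 < rp by lra.
have h (t : R) : 0 < t -> 2 * (2 * t)^-1 = t^-1 by move=> t0; field; rewrite gt_eqF.
by rewrite /c1 /c2 !h// !lef_pV2 ?posrE ?mulr_gt0//; split; lra.
Qed.

Lemma rp_gt0 : 0 < rp.
Proof. by have := steps 0; have := rm0; move=> r0 /andP[/andP[l1 l2] _]; lra. Qed.

Lemma c_ge0 k : 0 <= c1 k /\ 0 <= c2 k.
Proof.
have [h1 h2 _ _] := c_bounds k; have rp0 := rp_gt0.
have h : 0 <= (2 * rp)^-1 by rewrite invr_ge0 mulr_ge0 ?ltW.
by split; [exact: le_trans h1|exact: le_trans h2].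
Qed.

(** The previous iterate competes in each subproblem; on adding, the mixed value Q(x_{k+1}, y_k)
    cancels. A positive index ensures that [f (x k)] is finite. *)
Lemma descent k : (0 < k)%N ->
  V k.+1 + (2 * rp)^-1 *
    (enorm (x k.+1 - x k) ^+ 2 + enorm (y k.+1 - y k) ^+ 2) <= V k.
Proof.
case: k => // k _.
have [fx optx] := x_step (g_finite k.+1); have [gy opty] := y_step fx.
have := optx _ _ (f_finite k); have := opty _ _ (g_finite k.+1).
rewrite !subrr !enorm0 expr0n/= !mulr0.
have [h1 h2 _ _] := c_bounds k.+1.
have := ler_wpM2r (sqr_ge0 (enorm (x k.+2 - x k.+1))) h1.
have := ler_wpM2r (sqr_ge0 (enorm (y k.+2 - y k.+1))) h2.
by rewrite /V => *; lra.
Qed.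

Lemma V_decr k : (0 < k)%N -> V k.+1 <= V k.
Proof.
move/descent; apply: le_trans; rewrite lerDl mulr_ge0 ?addr_ge0 ?sqr_ge0//.
by rewrite invr_ge0 mulr_ge0// ltW// rp_gt0.
Qed.

(** * Convergence of the objective values to the value at the limit *)

Let Xs := fine (f xs).
Let Ys := fine (g ys).
Let Vs := Xs + Q (row_mx xs ys) + Ys.

Lemma finite_limit : [/\ f xs = Xs%:E, g ys = Ys%:E & L (row_mx xs ys) = Vs%:E].
Proof.
have [a [b []]] := objective_lty pf pg doms.
rewrite row_mxKl row_mxKr => fa gb.
by rewrite /L objective_row_mx /Vs /Xs /Ys fa gb.
Qed.

(** Lower semicontinuity of [f] and of [g] and continuity of [Q] each cost e/3. *)
Lemma V_lower (e : R) : 0 < e -> \forall k \near \oo, Vs - e < V k.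
Proof.
move=> e0; have [fxs gys _] := finite_limit; have e30 : 0 < e / 3 by lra.
have fl : ((Xs - e / 3)%:E < f xs)%E by rewrite fxs lte_fin; lra.
have gl : ((Ys - e / 3)%:E < g ys)%E by rewrite gys lte_fin; lra.
near=> k.
have : ((Xs - e / 3)%:E < f (x k))%E by near: k; exact: lower_semicontinuous_cvg fl.
have : ((Ys - e / 3)%:E < g (y k))%E by near: k; exact: lower_semicontinuous_cvg gl.
have : `|Q (row_mx xs ys) - Q (row_mx (x k) (y k))| < e / 3.
  near: k; apply: (continuous_cvg_near _ (cvg_row_mx xc yc)) => //.
have k0 : (0 < k)%N by near: k; exact: nbhs_infty_gt.
rewrite -(prednK k0) f_finite g_finite !lte_fin ltr_norml => /andP[q1 q2] g1 f1.
by rewrite /V /Vs; lra.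
Unshelve. all: by end_near. Qed.

(* The limit point competes in each of the two minimizations. *)
Lemma V_upper (e : R) : 0 < e -> \forall k \near \oo, V k < Vs + e.
Proof.
move=> e0; have [fxs gys _] := finite_limit.
have e80 : 0 < e / 8 by lra.
(* The cap 1 bounds the square by the norm, and the other entry then keeps each proximal term below
   e/8. With three errors in [Q] of e/8, the total is at most 5e/8. *)
pose d := Num.min 1 (e / 8 * (2 * rm)).
have d0 : 0 < d by rewrite lt_min ltr01 !mulr_gt0// rm0.
have xc' : x k.+1 @[k --> \oo] --> xs by rewrite (cvg_shiftS x).
have yc' : y k.+1 @[k --> \oo] --> ys by rewrite (cvg_shiftS y).
have quad d' (u v : 'rV[R]_d') c : 2 * c <= rm^-1 -> 0 <= c -> enorm (v - u) < d ->
    c * enorm (u - v) ^+ 2 <= e / 8.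
  move=> cr c0; rewrite enormB lt_min => /andP[v1 v2].
  have v0 := enorm_ge0 (u - v).
  have r0 := rm0.
  have crm : c * (2 * rm) <= 1.
    by rewrite mulrA (mulrC c) -ler_pdivlMr// div1r.
  apply: (@le_trans _ _ (c * (e / 8 * (2 * rm)))).
    by rewrite ler_wpM2l//; nra.
  by rewrite mulrCA ler_piMr// ltW.
suff : \forall k \near \oo, V k.+1 < Vs + e.
  by move=> [K _ HK]; exists K.+1 => //= -[//|k] Kk; exact: HK.
have near_Q (u v : nat -> _) : u j @[j --> \oo] --> xs -> v j @[j --> \oo] --> ys ->
    \forall j \near \oo, `|Q (row_mx xs ys) - Q (row_mx (u j) (v j))| < e / 8.
  by move=> uc vc; apply: continuous_cvg_near => //; exact: cvg_row_mx.
near=> k.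
have [fx optx] := x_step (g_finite k); have [gy opty] := y_step fx.
have [h1 h2 h3 h4] := c_bounds k.
have [c10 c20] := c_ge0 k.
have := optx _ _ fxs; have := opty _ _ gys.
have /(quad _ _ _ _ h3 c10) : enorm (x k - xs) < d by near: k; exact: cvg_enorm.
have /(quad _ _ _ _ h4 c20) : enorm (y k - ys) < d by near: k; exact: cvg_enorm.
have := mulr_ge0 c10 (sqr_ge0 (enorm (x k.+1 - x k))).
have := mulr_ge0 c20 (sqr_ge0 (enorm (y k.+1 - y k))).
have : `|Q (row_mx xs ys) - Q (row_mx (x k.+1) (y k))| < e / 8.
  by near: k; exact: (near_Q (fun k => x k.+1) y).
have : `|Q (row_mx xs ys) - Q (row_mx xs (y k))| < e / 8.
  by near: k; apply: (near_Q (fun=> xs) y) => //; exact: cvg_cst.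
have : `|Q (row_mx xs ys) - Q (row_mx (x k.+1) ys)| < e / 8.
  by near: k; apply: (near_Q (fun k => x k.+1) (fun=> ys)) => //; exact: cvg_cst.
rewrite !ltr_norml => /andP[? ?] /andP[? ?] /andP[? ?] ? ? ? ? ? ?.
by rewrite /V /Vs; lra.
Unshelve. all: by end_near. Qed.

(** A value below [Vs] would bound all later values by monotonicity, against [V_lower]. *)
Lemma V_ge k : (0 < k)%N -> Vs <= V k.
Proof.
move=> k0; rewrite leNgt; apply/negP => VkVs.
have [K _ /(_ (maxn k K) (leq_maxr _ _)) H] := V_lower (e := Vs - V k) ltac:(lra).
have : V (maxn k K) <= V k.
  rewrite -(subnKC (leq_maxl k K)); elim: (_ - _)%N => [|j IH]; first by rewrite addn0.
  by rewrite addnS (le_trans (V_decr _))// addn_gt0 k0.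
by move: H => /=; lra.
Qed.

(** The PLK inequality tested on [step_subgrad] gives P^q <= M |w|; squaring, |w|^2 is bounded by
    the squared step, and the squared step by the decrease of [V]. The constant multiplies the
    factors M^2, D and 2 rp from these three bounds. *)
Lemma PLK_recursion (M q : R) : 0 < M -> 0 <= q < 1 ->
  exponent_PLK L (row_mx xs ys) M q ->
  exists2 C, 0 < C & \forall k \near \oo, 0 < V k.+1 - Vs ->
    (V k.+1 - Vs) `^ (2 * q) <= C * (V k - V k.+1).
Proof.
move=> M0 /andP[q0 q1] [_ [eta [U [eta0 Uz PLK]]]].
have [_ _ Lzs] := finite_limit.
have r0 := rm0; have rp0 := rp_gt0.
(* One Lipschitz constant serves all late steps: both (x_{k+1}, y_{k+1}) and (x_{k+1}, y_k)
   eventually lie in this ball. *)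
have [K HK] := lipQ (bounded_enorm_ball (row_mx xs ys) 1).
pose D := 2 * K ^+ 2 + 3 * rm^-1 ^+ 2.
have D0 : 0 < D by rewrite ltr_wpDl ?mulr_gt0 ?exprn_gt0 ?invr_gt0// mulr_ge0// sqr_ge0.
exists (M ^+ 2 * (D * (2 * rp))); first by rewrite !mulr_gt0.
have xc' : x k.+1 @[k --> \oo] --> xs by rewrite (cvg_shiftS x).
have yc' : y k.+1 @[k --> \oo] --> ys by rewrite (cvg_shiftS y).
have Vnear : \forall k \near \oo, V k.+1 < Vs + eta.
  by have [N _ H] := V_upper eta0; exists N => //= j /= Nj; apply: H => /=; exact: leqW.
near=> k => P0; set P := V k.+1 - Vs.
have k0 : (0 < k)%N by near: k; exact: nbhs_infty_gt.
have zU : U (row_mx (x k.+1) (y k.+1)) by near: k; exact: (cvg_row_mx xc' yc').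
have zB1 : enorm (row_mx (x k.+1) (y k.+1) - row_mx xs ys) < 1.
  by near: k; apply: cvg_enorm => //; exact: cvg_row_mx.
have zB2 : enorm (row_mx (x k.+1) (y k) - row_mx xs ys) < 1.
  by near: k; apply: cvg_enorm => //; exact: cvg_row_mx.
have Veta : V k.+1 < Vs + eta by near: k.
have := PLK _ zU; rewrite Lzs objective_iterate// -EFinD !lte_fin Veta andbT.
rewrite -subr_gt0 => /(_ P0).
rewrite -EFinB /= derive1_scaled_powR//.
have [fx optx] := x_step (g_finite k); have [gy opty] := y_step fx.
have [h1 h2 h3 h4] := c_bounds k.
have [c10 c20] := c_ge0 k.
have sub := step_subgrad_frechet pf pg dQ c10 c20 fx gy optx opty.
have Wle := sqr_enorm_step_subgrad (x k) c10 c20 h3 h4 (HK _ _ zB1 zB2).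
move: sub Wle; set w := step_subgrad _ _ _ _ _ _ _ => sub Wle.
set A := M * _; have A0 : 0 <= A.
  by rewrite /A !mulr_ge0 ?powR_ge0//; lra.
move=> PLKw.
have {PLKw} : 1 <= A * enorm w.
  rewrite -lee_fin EFinM (le_trans PLKw)// lee_wpmul2l ?lee_fin//.
  exact: dist0_limiting_le.
have Pq : 0 < P `^ q by rewrite powR_gt0.
rewrite /A powRN => H.
have {H} PM : P `^ q <= M * enorm w.
  have w0 := enorm_ge0 w.
  (* The factor 1 - q from the derivative is at most 1 and is absorbed. *)
  apply: (@le_trans _ _ (M * (1 - q) * enorm w)).
    move: H; rewrite mulrA mulrAC -ler_pdivrMr ?invr_gt0// invrK mul1r.
    by [].
  by rewrite ler_wpM2r// ler_piMr ?(ltW M0)//; lra.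
have -> : P `^ (2 * q) = (P `^ q) ^+ 2.
  by rewrite mulrC powRrM -powR_mulrn// ltW.
apply: (@le_trans _ _ ((M * enorm w) ^+ 2)).
  by rewrite ler_sqr ?nnegrE ?(ltW Pq)// mulr_ge0 ?enorm_ge0// ltW.
rewrite exprMn -(mulrA (M ^+ 2)) ler_wpM2l ?sqr_ge0// (le_trans Wle)// -/D -(mulrA D).
rewrite ler_wpM2l ?(ltW D0)// -ler_pdivrMl ?mulr_gt0//.
by have := descent k0; lra.
Unshelve. all: by end_near. Qed.

(** Provides a real sequence with the hypotheses of the rate lemmas, equal to the extended-real gap
    from index 1 on. *)
Lemma real_gap_recursion (M q : R) : 0 < M -> 0 <= q < 1 ->
  exponent_PLK L (row_mx xs ys) M q ->
  exists (P : nat -> R) (C : R),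
    [/\ 0 < C,
        forall k, (0 < k)%N -> (L (row_mx (x k) (y k)) - L (row_mx xs ys) = (P k)%:E)%E,
        forall k, (0 < k)%N -> 0 <= P k /\ P k.+1 <= P k,
        forall e, 0 < e -> \forall k \near \oo, P k < e &
        \forall k \near \oo, 0 < P k.+1 ->
          P k.+1 `^ (2 * q) <= C * (P k - P k.+1)].
Proof.
move=> M0 q01 plk; have [C C0 rec] := PLK_recursion M0 q01 plk.
exists (fun k => V k - Vs), C; split=> //.
- by move=> k k0; have [_ _ ->] := finite_limit; rewrite objective_iterate// EFinB.
- by move=> k k0; rewrite subr_ge0 V_ge// lerD2r V_decr.
- by move=> e e0; near=> k; rewrite ltrBlDl; near: k; exact: V_upper.
- by near=> k; rewrite opprB addrA subrK; near: k.
Unshelve. all: by end_near. Qed.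

End Algorithm.

(** * Transfer of the rates to the extended-real gap *)

Theorem theorem4p2 (R : realType) (n m : nat)
    (f : 'rV[R]_n -> \bar R) (Q : 'rV[R]_(n + m) -> R)
    (g : 'rV[R]_m -> \bar R)
    (lambda mu : nat -> R)
    (x : nat -> 'rV[R]_n) (y : nat -> 'rV[R]_m)
    (xstar : 'rV[R]_n) (ystar : 'rV[R]_m) (M q : R) :
  let L := objective f Q g in
  let Psi := fun k : nat =>
    (L (row_mx (x k) (y k)) - L (row_mx xstar ystar))%E in
  assumptions_H f Q g ->
  assumptions_H1 L (y 0%N) lambda mu ->
  alternating_minimization L lambda mu x y ->
  x k @[k --> \oo] --> xstar ->
  y k @[k --> \oo] --> ystar ->
  0 < M ->
  0 <= q < 1 ->
  exponent_PLK L (row_mx xstar ystar) M q ->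
  [/\ q = 0 -> finite_termination Psi,
      0 < q < 2^-1 -> finite_termination Psi \/ superlinear_convergence Psi,
      q = 2^-1 -> linear_convergence Psi &
      2^-1 < q < 1 ->
        exists gamma : R, 0 < gamma /\
          forall k : nat, (1 <= k)%N ->
            (Psi k <= (gamma * k%:R `^ (- (2 * q - 1)^-1))%:E)%E].
Proof.
move=> L Psi [[pf lf] [pg lg] [dQ _] lipQ] [_ p0 [rm [rp [rm0 _ steps]]]] alt xc yc.
move=> M0 q01 plk; have q0 : 0 <= q by case/andP: q01.
have [P [C [C0 PsiE P01 Pcvg Prec]]] := real_gap_recursion pf pg lf lg dQ lipQ
  p0 rm0 steps alt xc yc plk.1 M0 q01 plk.
have P0 k : (0 < k)%N -> 0 <= P k by move/P01 => [].
have Pdecr k : (0 < k)%N -> P k.+1 <= P k by move/P01 => [].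
have finite : (\forall k \near \oo, P k = 0) -> finite_termination Psi.
  move=> PN; rewrite /finite_termination; near=> k.
  rewrite /Psi PsiE; last by near: k; exact: nbhs_infty_gt.
  by congr EFin; near: k.
(* Only eventual finiteness is available, since [Psi 0] may be +oo. *)
have Psi0 : Psi k @[k --> \oo] --> 0%E.
  apply: cvg_EFin.
    near=> k; rewrite /Psi PsiE//; near: k; exact: nbhs_infty_gt.
  apply/cvgrPdist_lt => e e0; near=> k.
  have k0 : (0 < k)%N by near: k; exact: nbhs_infty_gt.
  rewrite /= /Psi PsiE// sub0r normrN ger0_norm ?P0//.
  by near: k; exact: Pcvg.
split.
- by move=> qE; apply: finite; exact: (rate_finite C0 P0 Pdecr Pcvg Prec).
- move=> q2; have [/finite|Ppos] := gap_zero_or_pos P0 Pdecr; first by left.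
  right; split=> //.
    near=> k; have k0 : (0 < k)%N by near: k; exact: nbhs_infty_gt.
    by rewrite /Psi PsiE// eqe gt_eqF// Ppos.
  (* Positivity of [P k] turns the extended-real quotient into a real one. *)
  have PsiP k : (0 < k)%N -> (Psi k.+1 / Psi k)%E = (P k.+1 / P k)%:E.
    by move=> k0; rewrite /Psi !PsiE// inver gt_eqF ?Ppos.
  apply: cvg_EFin.
    near=> k; rewrite PsiP//; near: k; exact: nbhs_infty_gt.
  apply: cvg_trans; last exact: (rate_superlinear C0 Pdecr Pcvg Prec q2 Ppos).
  apply: near_eq_cvg; near=> k; rewrite /= PsiP//; near: k; exact: nbhs_infty_gt.
- move=> qE; split=> //.
  have [c [c01 Pc]] := rate_linear C0 P0 Prec qE.
  exists c; split=> //; near=> k.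
  have k0 : (0 < k)%N by near: k; exact: nbhs_infty_gt.
  by rewrite /Psi !PsiE// -EFinM lee_fin; near: k.
- move=> q2; have [gamma [gamma0 H]] := rate_sublinear C0 P0 Pdecr Prec q2.
  by exists gamma; split=> // k k0; rewrite /Psi PsiE// lee_fin H.
Unshelve. all: by end_near. Qed.
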